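(* (a) For every $p>\frac12$ and $\epsilon>0$ there is $\delta=\delta(p,\epsilon)>0$ such that for every weighted majority function $f:\{0,1\}^n\to\{0,1\}$ (for any $n$) and any probability distribution $\mu$ on $\{0,1\}^n$, if $e_k^{\mu}(f)\le\delta$ and $\mu[X_k=1]\ge p$ for all $k$, then $\mu[f]\ge 1-\epsilon$. In other words, if the effect of each variable is at most $\delta$ and the probability that each variable is $1$ is at least $p$, then $f=1$ with $\mu$-probability at least $1-\epsilon$. (b) If $f:\{0,1\}^n\to\{0,1\}$ is a monotone anti-symmetric function but not a weighted majority function, then there exists a probability distribution $\mu$ on $\{0,1\}^n$ such that $\mu[X_k=1]>\frac12$ for all $k$, yet $\mu[f]=0$ and $e_k^{\mu}(f)=0$ for all $k$. In other words, if $f$ is not a weighted majority function, then there is a probability measure $\mu$ for which $f=0$ with $\mu$-probability $1$, yet $\mu[X_k=1]>\frac12$ for all $k$. (Since $f$ is constant according to the measure $\mu$, all the effects are $0$ in this case.) (c) If $f:\{0,1\}^n\to\{0,1\}$ is monotone, anti-symmetric and invariant under a transitive group, but is not the (simple) majority function, then there exists a probability distribution $\mu$ on $\{0,1\}^n$ such that $\mu[X_k=1]>\frac12$ for all $k$, yet $\mu[f]=0$ and $e_k^{\mu}(f)=0$ for all $k$.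
   Context: A function $f:\{0,1\}^n\to\{0,1\}$ is monotone (non-decreasing) if $x_i\ge y_i$ for all $i$ implies $f(x_1,\dots,x_n)\ge f(y_1,\dots,y_n)$. It is anti-symmetric if $f(1-x_1,\dots,1-x_n)=1-f(x_1,\dots,x_n)$ for all $x\in\{0,1\}^n$. For a probability distribution $\mu$ on $\{0,1\}^n$, $(X_1,\dots,X_n)$ denotes a random vector with law $\mu$, and $\mu[f]$ denotes the expectation of $f(X_1,\dots,X_n)$ under $\mu$. The effect of the $k$-th variable on $f$ with respect to $\mu$ is $$e_k^{\mu}(f)=\mu[f(X_1,\dots,X_n)\mid X_k=1]-\mu[f(X_1,\dots,X_n)\mid X_k=0];$$ it is undefined if the probability of $X_k=1$ is $0$ or $1$. A condition on $e_k^{\mu}(f)$ is understood to include that this effect is defined. A monotone anti-symmetric function $f$ is a weighted majority function if there exist non-negative weights $w_1,\dots,w_n$, not all zero, such that $f(x_1,\dots,x_n)=1$ if $\sum_{i=1}^n w_i(2x_i-1)>0$ and $f(x_1,\dots,x_n)=0$ if $\sum_{i=1}^n w_i(2x_i-1)<0$. When the sum is $0$, $f(x)$ may be either $0$ or $1$, as long as $f$ is monotone and anti-symmetric. If $n$ is odd and $w_i=1$ for every $i$, $f$ is called the majority function (or simple majority); this term is defined only for $n$ odd. $f$ is invariant under a transitive group if there is a group of permutations $\Gamma\subset S_n$ (where $S_n$ is the full permutation group on $n$ elements) such that $f(x_1,\dots,x_n)=f(x_{\sigma(1)},\dots,x_{\sigma(n)})$ for all $\sigma\in\Gamma$ and all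 $x$, and for all $1\le i,j\le n$ there exists $\sigma\in\Gamma$ with $\sigma(i)=j$.
   Formalization: In (c), n is assumed odd (majority is defined only for odd n); for even n the literal claim fails, e.g. n=6 with ties at three ones broken by a PSL(2,5)-invariant family of 3-subsets, and the even cases where it holds (f not a weighted majority) are covered by (b). *)

(* Defs.v *)
From HB Require Import structures.
From mathcomp Require Import all_boot all_order all_algebra all_fingroup.
From mathcomp Require Import reals.

Set Implicit Arguments.
Unset Strict Implicit.
Unset Printing Implicit Defensive.

Import Order.TTheory GRing.Theory Num.Theory.

Local Open Scope ring_scope.

Definition cube (n : nat) := {ffun 'I_n -> bool}.

Section BooleanFunctions.
Variable n : nat.
Implicit Types f : cube n -> bool.

Definition monotone f :=
  forall x y : cube n, (forall i, (y i <= x i)%N) -> (f y <= f x)%N.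

Definition antisymmetric_fun f :=
  forall x : cube n, f [ffun i => ~~ x i] = ~~ f x.

Definition invariant_transitive f :=
  exists G : {group {perm 'I_n}},
    (forall s, s \in G -> forall x : cube n, f x = f [ffun i => x (s i)]) /\
    (forall i j : 'I_n, exists2 s, s \in G & s i = j).

End BooleanFunctions.

Section WeightedMajority.
Variables (R : realType) (n : nat).
Implicit Types (f : cube n -> bool) (w : 'I_n -> R).

Definition weighted_sum w (x : cube n) : R :=
  \sum_(i < n) w i * (2 * (x i)%:R - 1).

(* Nothing is imposed on [f x] when the weighted sum vanishes, beyond
   monotonicity and anti-symmetry of [f]. *)
Definition weighted_majority_with w f :=
  [/\ monotone f, antisymmetric_fun f,
      forall i, 0 <= w i,
      exists i, w i != 0 &
      forall x, (0 < weighted_sum w x -> f x = true) /\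
                (weighted_sum w x < 0 -> f x = false)].

Definition weighted_majority f := exists w, weighted_majority_with w f.

(* For odd [n] the sum with unit weights never vanishes, so this determines
   [f]; the notion is reserved to odd [n]. *)
Definition simple_majority f :=
  odd n /\ weighted_majority_with (fun=> 1) f.

End WeightedMajority.

Section Probability.
Variable R : realType.

Record distribution (T : finType) := Distribution {
  pmf :> T -> R;
  pmf_ge0 : forall x, 0 <= pmf x;
  pmf_sum1 : \sum_x pmf x = 1 }.

Section Finite.
Variables (T : finType) (mu : distribution T).

Definition prob (A : pred T) : R := \sum_(x | A x) mu x.

Definition expectation (g : T -> R) : R := \sum_x mu x * g x.

(* Takes the junk value 0 when [prob A = 0]. *)
Definition cond_expectation (g : T -> R) (A : pred T) : R :=
  (\sum_(x | A x) mu x * g x) / prob A.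

End Finite.

Variables (n : nat) (mu : distribution (cube n)).

Definition prob1 (k : 'I_n) : R := prob mu (fun x => x k).

Definition mean (f : cube n -> bool) : R := expectation mu (fun x => (f x)%:R).

Definition effect_defined (k : 'I_n) := prob1 k <> 0 /\ prob1 k <> 1.

(* Only meaningful together with [effect_defined k]. *)
Definition effect (f : cube n -> bool) (k : 'I_n) : R :=
  cond_expectation mu (fun x => (f x)%:R) (fun x => x k) -
  cond_expectation mu (fun x => (f x)%:R) (fun x => ~~ x k).

End Probability.

(* Main.v *)
Require Import Defs.
From HB Require Import structures.
From mathcomp Require Import all_boot all_order all_algebra all_fingroup.
From mathcomp Require Import ring lra.
From mathcomp Require Import reals.

(** Both directions compare a function [f] with the signed sum
    [S = \sum_i w i * (2 * X_i - 1)].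

    Suppose that [f] is a weighted majority with weights [w].  Wherever
    [f = 0] one has [S <= 0], so the covariance of [f] and [S] is at least
    [mu (f = 0)] times the mean of [S].  This mean is at least [2 * p - 1]
    times the total weight.  On the other hand the covariance of [f] and [X_k]
    is the effect of [k] times the variance of [X_k]; if all effects are at
    most [delta], the covariance of [f] and [S] is at most [2 * delta] times
    the total weight.  The total weight cancels, leaving a bound on
    [mu (f = 0)] linear in [delta] and independent of [n]
    (mean_ge_of_small_effects).

    The converse is linear programming duality, in the form of Ville's theorem
    (ville, deduced from farkas).  Applied to the vectors [2 * x - 1] for the
    zeros [x] of [f], it gives either nonnegative weights for which the signed
    sum is at most 0 at every zero of [f], and then antisymmetry makes [f] a
    weighted majority (weighted_majority_of_zeros); or a measure carried by
    the zeros of [f] under which every coordinate is more likely to be 1 than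
    0.  Under this measure [f] is constant, so all its effects vanish; some mass
    at the all-zeros point keeps every coordinate random, so that the effects
    are defined (biased_distribution_on_zeros).

    If [f] is moreover invariant under a transitive group, averaging the
    weights of a weighted majority over the group makes them all equal
    (transitive_weighted_majority), so that such an [f] which is not the simple
    majority is not a weighted majority at all. *)

Set Implicit Arguments.
Unset Strict Implicit.
Unset Printing Implicit Defensive.

Import Order.TTheory GRing.Theory Num.Theory.

Local Open Scope ring_scope.

(** * Alternatives for systems of linear inequalities *)

Section LinearAlternative.
Variables (R : realFieldType) (n : nat).
Implicit Types u v w : 'rV[R]_n.

Definition dot u w : R := \sum_k u 0 k * w 0 k.

Lemma dotC u w : dot u w = dot w u.
Proof. by apply: eq_bigr => k _; rewrite mulrC. Qed.

Lemma dotBZl u (t : R) v w : dot (u - t *: v) w = dot u w - t * dot v w.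
Proof.
rewrite /dot mulr_sumr -sumrB; apply: eq_bigr => k _.
by rewrite !mxE mulrBl mulrA.
Qed.

Lemma dotBZr u w (t : R) v : dot u (w - t *: v) = dot u w - t * dot u v.
Proof. by rewrite dotC dotBZl (dotC w) (dotC v). Qed.

Lemma dot_gt0 u : u != 0 -> 0 < dot u u.
Proof.
move=> u0; have ge0 k : true -> 0 <= u 0 k * u 0 k by rewrite -expr2 sqr_ge0.
rewrite lt_neqAle sumr_ge0 ?andbT //; apply: contra u0 => /eqP/esym/eqP.
rewrite psumr_eq0 // => /allP u0; apply/eqP/rowP => k; rewrite mxE.
by have := u0 k (mem_index_enum _); rewrite mulf_eq0 orbb => /eqP.
Qed.

(** Farkas's lemma: a vector [c] outside the cone spanned by the [a i] is
    separated from it.  Induction on the number of generators.  If a separator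
    [w] for the first generators fails because [dot (a j) w > 0], every vector
    is projected along [a j] onto the hyperplane orthogonal to [w], and the
    induction hypothesis is applied a second time.  A separator for the
    projected system yields one orthogonal to [a j]; a combination for it lifts
    back, and the signs at [w] make the coefficient of [a j] nonnegative. *)
Lemma farkas (I : eqType) (r : seq I) (a : I -> 'rV[R]_n) (c : 'rV[R]_n) :
  uniq r ->
  (exists2 w, forall i, i \in r -> dot (a i) w <= 0 & 0 < dot c w) \/
  (exists2 l : I -> R, forall i, 0 <= l i & c = \sum_(i <- r) l i *: a i).
Proof.
elim: r a c => [|j r IHr] a c /=.
  move=> _; have [->|c0] := eqVneq c 0.
    by right; exists (fun=> 0) => //; rewrite big_nil.
  by left; exists c => //; exact: dot_gt0.
case/andP=> jr Ur.
have sum_new (l : I -> R) t (b : I -> 'rV[R]_n) :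
    \sum_(i <- r) (if i == j then t else l i) *: b i =
    \sum_(i <- r) l i *: b i.
  rewrite big_seq [RHS]big_seq; apply: eq_bigr => i ir.
  by case: eqP => // ij; rewrite -ij ir in jr.
case: (IHr a c Ur) => [[w wr wc]|[l l0 cE]]; last first.
  right; exists (fun i => if i == j then 0 else l i) => [i|].
    by case: ifP.
  by rewrite big_cons eqxx scale0r add0r sum_new.
have [wj|wj] := lerP (dot (a j) w) 0.
  left; exists w => // i; rewrite inE => /predU1P[->|] //; exact: wr.
have wj0 : dot (a j) w != 0 by rewrite gt_eqF.
pose proj u := u - (dot u w / dot (a j) w) *: a j.
case: (IHr (fun i => proj (a i)) (proj c) Ur) => [[y yr yc]|[l l0 cE]].
  left; pose z := y - (dot (a j) y / dot (a j) w) *: w.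
  have dotz u : dot u z = dot (proj u) y.
    by rewrite /proj dotBZr dotBZl; congr (_ - _); rewrite mulrAC [RHS]mulrAC
      [dot (a j) y * _]mulrC.
  exists z; last by rewrite dotz.
  move=> i; rewrite inE => /predU1P[->|/yr]; last by rewrite dotz.
  by rewrite /z dotBZr divfK // subrr.
right.
pose t := (dot c w - \sum_(i <- r) l i * dot (a i) w) / dot (a j) w.
have t0 : 0 <= t.
  rewrite divr_ge0 ?ltW // subr_gt0 (le_lt_trans _ wc) //.
  rewrite big_seq sumr_le0 // => i ir.
  by rewrite mulr_ge0_le0 // wr.
exists (fun i => if i == j then t else l i) => [i|]; first by case: ifP.
rewrite big_cons eqxx sum_new.
have -> : c = proj c + (dot c w / dot (a j) w) *: a j by rewrite subrK.
rewrite {}cE /t mulrBl scalerBl.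
have -> : \sum_(i <- r) l i *: proj (a i) = \sum_(i <- r) l i *: a i -
    ((\sum_(i <- r) l i * dot (a i) w) / dot (a j) w) *: a j.
  rewrite mulr_suml scaler_suml -sumrB; apply: eq_bigr => i _.
  by rewrite scalerBr scalerA mulrA.
by rewrite -addrA addrC [- _ + _]addrC.
Qed.

End LinearAlternative.

(** Ville's theorem of the alternative: Farkas's lemma for the cone spanned by
    the [a i] and the vectors [- delta_mx 0 k], tested on the all-ones
    vector.  The second family makes a separator nonnegative, and turns an
    equality with the all-ones vector into a lower bound by 1. *)
Lemma ville (R : realFieldType) (n : nat) (I : finType) (a : I -> 'I_n -> R) :
  (exists w : 'I_n -> R, [/\ forall k, 0 <= w k, exists k, w k != 0 &
     forall i, \sum_k w k * a i k <= 0]) \/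
  (exists2 l : I -> R, forall i, 0 <= l i &
     forall k, 1 <= \sum_i l i * a i k).
Proof.
pose g (j : I + 'I_n) : 'rV[R]_n :=
  match j with inl i => \row_k a i k | inr k => - delta_mx 0 k end.
have Ug := index_enum_uniq (I + 'I_n)%type.
case: (farkas g (const_mx 1) Ug) => [[w wg w1]|[l l0 lE]].
  left; exists (w 0); split => [k||i].
  - have := wg (inr k) (mem_index_enum _); rewrite /dot (bigD1 k) //= big1.
      by rewrite addr0 !mxE !eqxx mulN1r oppr_le0.
    by move=> m mk; rewrite !mxE (negPf mk) oppr0 mul0r.
  - apply/existsP; apply: contraLR w1 => /existsPn w0.
    rewrite -leNgt /dot big1 // => k _.
    by have /negPn/eqP -> := w0 k; rewrite mulr0.
  - have := wg (inl i) (mem_index_enum _); congr (_ <= 0).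
    by apply: eq_bigr => k _; rewrite mxE mulrC.
right; exists (fun i => l (inl i)) => // k.
have := congr1 (fun u : 'rV[R]_n => u 0 k) lE.
rewrite big_sumType /= !mxE !summxE => ->.
rewrite [X in X + _](eq_bigr (fun i => l (inl i) * a i k)) => [|i _]; last first.
  by rewrite !mxE.
rewrite gerDl sumr_le0 // => m _.
by rewrite !mxE mulrN oppr_le0 mulr_ge0 ?l0 //; case: (_ && _).
Qed.

(** * Small effects *)

Section SmallEffects.
Variables (R : realType) (n : nat) (mu : distribution R (cube n)).
Implicit Types (f : cube n -> bool) (k : 'I_n).

Lemma prob1_ge0 k : 0 <= prob1 mu k.
Proof. by apply: sumr_ge0 => x _; exact: pmf_ge0. Qed.

Lemma prob1C k : prob mu (fun x => ~~ x k) = 1 - prob1 mu k.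
Proof.
by rewrite -(pmf_sum1 mu) (bigID (fun x : cube n => x k)) /= addrAC subrr add0r.
Qed.

Lemma prob1_le1 k : prob1 mu k <= 1.
Proof.
by rewrite -subr_ge0 -prob1C; apply: sumr_ge0 => x _; exact: pmf_ge0.
Qed.

Lemma mean_le1 f : mean mu f <= 1.
Proof.
rewrite -(pmf_sum1 mu); apply: ler_sum => x _.
by rewrite ler_piMr ?pmf_ge0 //; case: (f x).
Qed.

(** The effect is the covariance of [f] and [X_k] divided by the variance
    [q * (1 - q)] of [X_k], and this variance is at most 1. *)
Lemma covariance_le_effect f k (delta : R) : 0 <= delta ->
  effect_defined mu k -> effect mu f k <= delta ->
  \sum_(x : cube n | x k) mu x * (f x)%:R <= prob1 mu k * mean mu f + delta.
Proof.
move=> d0 [/eqP q0 /eqP q1]; rewrite /effect /cond_expectation prob1C.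
rewrite -/(prob1 mu k) /mean /expectation.
rewrite [X in _ -> _ <= _ * X + _](bigID (fun x : cube n => x k)) /=.
set A := \sum_(x : cube n | x k) _; set B := \sum_(x : cube n | ~~ x k) _.
move: (prob1_ge0 k) (prob1_le1 k) q0 q1.
set q := prob1 mu k => q_ge0 q_le1 q0 q1.
have qp : 0 < q by rewrite lt_neqAle eq_sym q0.
have q1p : 0 < 1 - q by rewrite subr_gt0 lt_neqAle q1.
have -> : A / q - B / (1 - q) = (A - q * (A + B)) / (q * (1 - q)).
  by field; rewrite q0 gt_eqF.
rewrite ler_pdivrMr ?mulr_gt0 // => le.
have : delta * (q * (1 - q)) <= delta.
  by rewrite ler_piMr // mulr_ile1 //; lra.
lra.
Qed.

End SmallEffects.

(** Where [f = 0] the weighted sum [S] is at most 0, so the covariance of [f]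
    and [S] is at least [mu (f = 0)] times the mean of [S].  Small effects
    bound this covariance from above, and the mean of [S] is at least
    [2 * p - 1] times the total weight. *)
Lemma mean_ge_of_small_effects (R : realType) (n : nat) (f : cube n -> bool)
    (mu : distribution R (cube n)) (p delta : R) :
  1 / 2 < p -> 0 <= delta -> weighted_majority R f ->
  (forall k, effect_defined mu k /\ effect mu f k <= delta) ->
  (forall k, p <= prob1 mu k) ->
  (1 - mean mu f) * (2 * p - 1) <= 2 * delta.
Proof.
move=> p_gt d0 [w [_ _ w0 [k0 wk0] wf]] eff pP.
pose A k := \sum_(x : cube n | x k) mu x * (f x)%:R.
have W0 : 0 < \sum_k w k.
  rewrite (bigD1 k0) //= ltr_pwDl ?sumr_ge0 //.
  by rewrite lt_neqAle eq_sym wk0 w0.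
(* The mean of (1 - f) S, expanded coordinate by coordinate. *)
have S_le0 :
    \sum_k w k * (2 * (prob1 mu k - A k) - (1 - mean mu f)) <= 0.
  have -> : \sum_k w k * (2 * (prob1 mu k - A k) - (1 - mean mu f)) =
      \sum_x mu x * (1 - (f x)%:R) * weighted_sum w x.
    under [RHS]eq_bigr do rewrite mulr_sumr.
    rewrite exchange_big; apply: eq_bigr => k _ /=.
    have -> : prob1 mu k = \sum_x mu x * (x k)%:R.
      rewrite /prob1 /prob big_mkcond; apply: eq_bigr => x _.
      by case: (x k); rewrite ?mulr1 ?mulr0.
    have -> : A k = \sum_x mu x * (f x)%:R * (x k)%:R.
      rewrite /A big_mkcond; apply: eq_bigr => x _.
      by case: (x k); rewrite ?mulr1 ?mulr0.
    rewrite -[X in X - mean _ _](pmf_sum1 mu) /mean /expectation -!sumrB mulr_sumr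
      -sumrB mulr_sumr.
    apply: eq_bigr => x _; ring.
  rewrite sumr_le0 // => x _; case fx: (f x); first by rewrite subrr mulr0 mul0r.
  rewrite subr0 mulr1 mulr_ge0_le0 ?pmf_ge0 // leNgt.
  by apply/negP => /(proj1 (wf x)); rewrite fx.
have : (\sum_k w k) * ((1 - mean mu f) * (2 * p - 1) - 2 * delta) <= 0.
  apply: le_trans S_le0; rewrite mulr_suml; apply: ler_sum => k _.
  apply: ler_wpM2l => //; case: (eff k) => kdef ek.
  have := covariance_le_effect d0 kdef ek; rewrite -/(A k) => covA.
  have : (1 - mean mu f) * p <= (1 - mean mu f) * prob1 mu k.
    by rewrite ler_wpM2l // subr_ge0 mean_le1.
  lra.
by rewrite pmulr_rle0 // subr_le0.
Qed.

(** * Functions that are not weighted majorities *)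

Section Antisymmetric.
Variables (R : realType) (n : nat) (f : cube n -> bool).
Hypotheses (f_mono : monotone f) (f_anti : antisymmetric_fun f).

Lemma weighted_sumC (w : 'I_n -> R) (x : cube n) :
  weighted_sum w [ffun i => ~~ x i] = - weighted_sum w x.
Proof.
rewrite /weighted_sum -sumrN; apply: eq_bigr => i _.
by rewrite ffunE; case: (x i) => /=; ring.
Qed.

(** Antisymmetry turns the condition on the zeros of [f] into the one on its
    ones. *)
Lemma weighted_majority_of_zeros (w : 'I_n -> R) :
  (forall i, 0 <= w i) -> (exists i, w i != 0) ->
  (forall x, f x = false -> weighted_sum w x <= 0) ->
  weighted_majority_with w f.
Proof.
move=> w0 wn0 wf; split=> // x; split=> Sx.
  by case fx: (f x) => //; move: Sx; rewrite ltNge wf.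
case fx: (f x) => //; have := wf [ffun i => ~~ x i].
by rewrite f_anti fx weighted_sumC oppr_le0 leNgt Sx => /(_ erefl).
Qed.

Lemma antisymmetric_false : f [ffun=> false] = false.
Proof.
have -> : [ffun=> false] = [ffun i => ~~ [ffun=> true] i] :> cube n.
  by apply/ffunP => i; rewrite !ffunE.
have le i : ([ffun i => ~~ [ffun=> true] i] i <= ([ffun=> true] : cube n) i)%N.
  by rewrite !ffunE.
by have := f_mono le; rewrite f_anti; case: (f _).
Qed.

(** Weights [l x] on the zeros of [f] whose signed marginals are at least 1
    come from Ville's theorem.  Half a unit of mass is added at the all-zeros
    point: the marginals stay biased towards 1, but are no longer sure. *)
Lemma biased_distribution_on_zeros : ~ weighted_majority R f ->
  exists mu : distribution R (cube n),
    [/\ forall k, 1 / 2 < prob1 mu k, forall k, prob1 mu k < 1 &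
        forall x, f x -> mu x = 0].
Proof.
move=> notWM.
pose a (x : cube n) k : R := if f x then 0 else 2 * (x k)%:R - 1.
case: (ville a) => [[w [w0 wn0 wa]]|[l l0 la]].
  case: notWM; exists w; apply: weighted_majority_of_zeros => // x fx.
  by have := wa x; rewrite /a fx.
pose o : cube n := [ffun=> false].
pose m x : R := (if f x then 0 else l x) + (x == o)%:R / 2.
have m0 x : 0 <= m x.
  by rewrite addr_ge0 ?divr_ge0 //; case: ifP.
have mo : 0 < m o.
  by rewrite /m eqxx antisymmetric_false ltr_wpDl // divr_gt0.
pose M := \sum_x m x.
have M0 : 0 < M by rewrite /M (bigD1 o) //= ltr_pwDl // sumr_ge0.
have nu0 x : 0 <= m x / M by rewrite divr_ge0 // ltW.
have nu1 : \sum_x m x / M = 1 by rewrite -mulr_suml divff // gt_eqF.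
have signed k : 1 / 2 <= \sum_x m x * (2 * (x k)%:R - 1).
  have -> : \sum_x m x * (2 * (x k)%:R - 1) = \sum_x l x * a x k - 1 / 2.
    rewrite /m; under eq_bigr do rewrite mulrDl.
    rewrite big_split /=; congr (_ + _).
      by apply: eq_bigr => x _; rewrite /a; case: ifP; rewrite ?mul0r ?mulr0.
    rewrite (bigD1 o) //= big1 => [|x /negPf ->]; last by rewrite !mul0r.
    by rewrite eqxx ffunE /=; field.
  by have := la k; lra.
exists (Distribution nu0 nu1); split=> [k|k|x fx] /=.
- rewrite /prob1 /prob /= -mulr_suml ltr_pdivlMr //.
  have := signed k; under eq_bigr do rewrite mulrBr mulr1.
  rewrite sumrB -/M.
  have -> : \sum_x m x * (2 * (x k)%:R) = 2 * \sum_(x : cube n | x k) m x.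
    rewrite mulr_sumr [RHS]big_mkcond; apply: eq_bigr => x _.
    by case: (x k); rewrite /= ?mulr1 ?mulr0 // mulrC.
  lra.
- rewrite /prob1 /prob /= -mulr_suml ltr_pdivrMr // mul1r /M.
  rewrite [X in _ < X](bigID (fun x : cube n => x k)) /= ltrDl.
  by rewrite (bigD1 o) ?ffunE //= ltr_pwDl // sumr_ge0.
- rewrite /m fx; case: eqP => [xo|_]; last by rewrite !mul0r addr0 mul0r.
  by rewrite xo antisymmetric_false in fx.
Qed.

Lemma biased_distribution_without_effects : ~ weighted_majority R f ->
  exists mu : distribution R (cube n),
    [/\ forall k, 1 / 2 < prob1 mu k, mean mu f = 0 &
        forall k, effect_defined mu k /\ effect mu f k = 0].
Proof.
case/biased_distribution_on_zeros=> mu [mu_gt mu_lt muf].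
have muf0 x : mu x * (f x)%:R = 0.
  by case fx: (f x); rewrite ?mulr0 // muf // mul0r.
exists mu; split=> //; first by apply: big1 => x _.
move=> k; split.
  have q0 : 0 < prob1 mu k by apply: lt_trans (mu_gt k); rewrite divr_gt0.
  by split; apply/eqP; rewrite ?(gt_eqF q0) ?(lt_eqF (mu_lt k)).
by rewrite /effect /cond_expectation !big1 // !mul0r subrr.
Qed.

(** The group permutes the zeros of [f].  Summing [weighted_sum w] over the
    images of a zero [x] gives [\sum_i w i] times the sum of [2 * x - 1] over
    the images of one coordinate, which by transitivity does not depend on the
    coordinate.  Hence that sum is at most 0, and adding it up over all
    coordinates shows that unit weights serve as well. *)
Lemma transitive_weighted_majority :
  odd n -> invariant_transitive f -> weighted_majority R f ->
  simple_majority R f.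
Proof.
move=> n_odd [G [Gf Gtr]] [w [_ _ w0 [k0 wk0] wf]]; split=> //.
apply: weighted_majority_of_zeros => [i|| x fx] //.
  by exists k0; exact: oner_neq0.
pose v i : R := 2 * (x i)%:R - 1.
pose T i := \sum_(s in G) v (s i).
have T_const i : T i = T k0.
  have [t tG <-] := Gtr k0 i; rewrite /T.
  rewrite [RHS](reindex_inj (mulgI t)) /=; apply: eq_big => s.
    by rewrite groupMl.
  by rewrite permM.
have T_le0 : T k0 <= 0.
  have W0 : 0 < \sum_k w k.
    rewrite (bigD1 k0) //= ltr_pwDl ?sumr_ge0 //.
    by rewrite lt_neqAle eq_sym wk0 w0.
  rewrite -(pmulr_rle0 _ W0) mulr_suml.
  under eq_bigr => i _ do rewrite -(T_const i) /T mulr_sumr.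
  rewrite exchange_big sumr_le0 //= => s sG.
  have := proj1 (wf [ffun i => x (s i)]); rewrite -(Gf s sG) fx => wfs.
  rewrite leNgt; apply/negP => pos.
  suff /wfs : 0 < weighted_sum w [ffun i => x (s i)] by [].
  by rewrite /weighted_sum; under eq_bigr do rewrite ffunE.
have G0 : 0 < #|G|%:R :> R by rewrite ltr0n cardG_gt0.
rewrite -(pmulr_rle0 _ G0) /weighted_sum.
under eq_bigr do rewrite mul1r.
have -> : #|G|%:R * (\sum_i v i) = \sum_i T i.
  rewrite exchange_big /= mulr_natl -sumr_const.
  by apply: eq_bigr => s _; rewrite [LHS](reindex_inj (@perm_inj _ s)).
by apply: sumr_le0 => i _; rewrite T_const.
Qed.

End Antisymmetric.

Theorem theorem1p2 (R : realType) :
  [/\ (* (a) *)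
      forall p eps : R, 1 / 2 < p -> 0 < eps ->
      exists delta : R, 0 < delta /\
        forall (n : nat) (f : cube n -> bool) (mu : distribution R (cube n)),
          weighted_majority R f ->
          (forall k, effect_defined mu k /\ effect mu f k <= delta) ->
          (forall k, p <= prob1 mu k) ->
          1 - eps <= mean mu f,
      (* (b) *)
      forall (n : nat) (f : cube n -> bool),
        monotone f -> antisymmetric_fun f -> ~ weighted_majority R f ->
        exists mu : distribution R (cube n),
          [/\ forall k, 1 / 2 < prob1 mu k,
              mean mu f = 0 &
              forall k, effect_defined mu k /\ effect mu f k = 0] &
      (* (c) *)
      forall (n : nat) (f : cube n -> bool),
        odd n ->
        monotone f -> antisymmetric_fun f -> invariant_transitive f ->
        ~ simple_majority R f ->
        exists mu : distribution R (cube n),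
          [/\ forall k, 1 / 2 < prob1 mu k,
              mean mu f = 0 &
              forall k, effect_defined mu k /\ effect mu f k = 0]].
Proof.
split.
- move=> p eps p_gt eps0.
  have c0 : 0 < 2 * p - 1 by lra.
  have d0 : 0 < eps * (2 * p - 1) / 2 by rewrite divr_gt0 ?mulr_gt0.
  exists (eps * (2 * p - 1) / 2); split=> // n f mu wm eff pP.
  have := mean_ge_of_small_effects p_gt (ltW d0) wm eff pP.
  by rewrite [2 * (_ / 2)]mulrC divfK ?pnatr_eq0 // ler_pM2r //; lra.
- by move=> n f mono anti; exact: biased_distribution_without_effects.
- move=> n f n_odd mono anti tr not_maj.
  apply: biased_distribution_without_effects => // wm.
  by apply: not_maj; exact: transitive_weighted_majority.
Qed.
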